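(* Let $(J,g)$ be a metallic Riemannian structure on a smooth manifold $M$ with $J^2=pJ+qI$, $p,q\in\mathbb{R}$, let $\nabla$ be a linear connection on $M$, and let $\hat{J}_m:=\begin{pmatrix} J & 0\\ 0 & J^*\end{pmatrix}$ be the induced generalized metallic structure on $TM\oplus T^*M$, i.e. $\hat J_m(X+\alpha)=JX+J^*\alpha$. Then $\hat{J}_m$ is $\nabla$-integrable if and only if $J$ is integrable and $\nabla_{JX}J=(\nabla_X J)J$ for every $X\in C^\infty(TM)$.
   Context: A metallic Riemannian structure $(J,g)$ on $M$ consists of a $(1,1)$-tensor field $J:TM\to TM$ with $J^2=pJ+qI$ for some real numbers $p,q$, and a Riemannian metric $g$ with $g(JX,Y)=g(X,JY)$ for all vector fields $X,Y$. $C^\infty(E)$ denotes the smooth sections of a bundle $E$. $J$ is integrable if $N_J(X,Y):=[JX,JY]-J[JX,Y]-J[X,JY]+J^2[X,Y]$ vanishes for all $X,Y\in C^\infty(TM)$. $J^*:T^*M\to T^*M$ is defined by $(J^*\alpha)(X):=\alpha(JX)$. A generalized metallic structure on $M$ is an endomorphism $\hat J$ of $TM\oplus T^*M$ with $\hat J^2=p\hat J+qI$ for some $p,q\in\mathbb R$. For a linear connection $\nabla$ on $M$, the bracket on $C^\infty(TM\oplus T^*M)$ is $[X+\alpha,Y+\beta]_\nabla:=[X,Y]+\nabla_X\beta-\nabla_Y\alpha$. An endomorphism $\hat J$ of $TM\oplus T^*M$ is $\nabla$-integrable if $N^\nabla_{\hat J}(\sigma,\tau):=[\hat J\sigma,\hat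 J\tau]_\nabla-\hat J[\hat J\sigma,\tau]_\nabla-\hat J[\sigma,\hat J\tau]_\nabla+\hat J^2[\sigma,\tau]_\nabla$ vanishes for all $\sigma,\tau\in C^\infty(TM\oplus T^*M)$. *)

(* Defs.v *)
From HB Require Import structures.
From mathcomp Require Import all_boot all_order all_algebra.
From mathcomp Require Import ring.
From mathcomp Require Import all_classical all_reals all_analysis.

Set Implicit Arguments.
Unset Strict Implicit.
Unset Printing Implicit Defensive.

Import Order.TTheory GRing.Theory Num.Theory.
Import numFieldNormedType.Exports.

Local Open Scope classical_set_scope.
Local Open Scope ring_scope.

Section Euclidean.
Variables (R : realType) (n : nat).
Implicit Types (U : set 'rV[R]_n) (f g : 'rV[R]_n -> R).

(* Only meaningful when [U] is open: continuity and differentiability are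
   those of [f] as a function on the whole space, at the points of [U]. *)
Fixpoint Ck (k : nat) U f : Prop :=
  (forall x, U x -> {for x, continuous f}) /\
  (if k is k'.+1 then
     forall i : 'I_n, (forall x, U x -> derivable f x (delta_mx 0 i)) /\
                      Ck k' U (fun x => 'D_(delta_mx 0 i) f x)
   else True).

Definition smooth_on U f := forall k, Ck k U f.

Lemma open_near_eq U f g x : open U -> (forall y, U y -> f y = g y) -> U x ->
  {near x, f =1 g}.
Proof.
by move=> oU fg Ux; apply: filterS (open_nbhs_nbhs (conj oU Ux)) => y /fg.
Qed.

Lemma eq_Ck k U f g : open U -> (forall x, U x -> f x = g x) ->
  Ck k U f -> Ck k U g.
Proof.
move=> oU; elim: k f g => [|k IH] f g fg [cf Df].
  split=> // x Ux; rewrite /prop_for /continuous_at -(fg x Ux).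
  by apply: cvg_trans (cf x Ux); exact: (near_eq_cvg (open_near_eq oU fg Ux)).
split=> [x Ux|i].
  rewrite /prop_for /continuous_at -(fg x Ux).
  by apply: cvg_trans (cf x Ux); exact: (near_eq_cvg (open_near_eq oU fg Ux)).
have [dfi Cfi] := Df i; split=> [x Ux|].
  by apply: near_eq_derivable (dfi x Ux); exact: open_near_eq oU fg Ux.
by apply: IH Cfi => x Ux; apply: near_eq_derive; exact: (open_near_eq oU fg Ux).
Qed.

Lemma CkS k U f : Ck k.+1 U f -> Ck k U f.
Proof.
elim: k f => [|k IH] f; first by case.
by move=> [cf Df]; split=> // i; have [dfi Cfi] := Df i; split=> //; exact: IH.
Qed.

Lemma Ck_cst k U (c : R) : open U -> Ck k U (cst c).
Proof.
move=> oU; elim: k c => [|k IH] c; split=> //; try by move=> x _; exact: cst_continuous.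
move=> i; split; first by move=> x _; exact: (derivable_cst c x).
by apply: eq_Ck (IH 0) => // x _; rewrite derive_cst.
Qed.

Lemma Ck_add k U f g : open U -> Ck k U f -> Ck k U g -> Ck k U (f \+ g).
Proof.
move=> oU; elim: k f g => [|k IH] f g /= [cf Df] [cg Dg]; split=> //;
  try by move=> x Ux; apply: continuousD; [exact: cf|exact: cg].
move=> i; have [dfi Cfi] := Df i; have [dgi Cgi] := Dg i; split.
  by move=> x Ux; apply: derivableD; [exact: dfi|exact: dgi].
apply: eq_Ck (IH _ _ Cfi Cgi) => // x Ux /=.
by rewrite deriveD //; [exact: dfi|exact: dgi].
Qed.

Lemma Ck_mul k U f g : open U -> Ck k U f -> Ck k U g -> Ck k U (f \* g).
Proof.
move=> oU; elim: k f g => [|k IH] f g Cf Cg; have [cf Df] := Cf;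
  have [cg Dg] := Cg; split=> //;
  try by move=> x Ux; apply: continuousM; [exact: cf|exact: cg].
move=> i; have [dfi Cfi] := Df i; have [dgi Cgi] := Dg i; split.
  by move=> x Ux; apply: derivableM; [exact: dfi|exact: dgi].
apply: eq_Ck (Ck_add oU (IH _ _ (CkS Cf) Cgi) (IH _ _ (CkS Cg) Cfi)) => //.
by move=> x Ux /=; rewrite deriveM //; [exact: dfi|exact: dgi].
Qed.

End Euclidean.

(* [chart_inv] is only relevant on the (open) image of the domain. *)
Record chart (R : realType) (n : nat) (T : topologicalType) := Chart {
  chart_dom : set T;
  chart_map :> T -> 'rV[R]_n;
  chart_inv : 'rV[R]_n -> T;
  chart_dom_open : open chart_dom;
  chart_img_open : open (chart_map @` chart_dom);
  chart_mapK : forall x, chart_dom x -> chart_inv (chart_map x) = x;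
  chart_map_continuous :
    forall x, chart_dom x -> {for x, continuous chart_map};
  chart_inv_continuous :
    forall v, (chart_map @` chart_dom) v -> {for v, continuous chart_inv}
}.

Arguments chart_dom_open {R n T} c : rename.
Arguments chart_img_open {R n T} c : rename.

Definition smooth_transition (R : realType) n (T : topologicalType)
    (c d : chart R n T) :=
  forall i : 'I_n, smooth_on (c @` (chart_dom c `&` chart_dom d))
                             (fun v => d (chart_inv c v) 0 i).

(* The atlas need not be maximal: the smooth functions are the same for an
   atlas and for the maximal atlas containing it. *)
Record manifold (R : realType) (n : nat) := Manifold {
  msort :> topologicalType;
  atlas : set (chart R n msort);
  manifold_hausdorff : hausdorff_space msort;
  manifold_second_countable : @second_countable msort;
  atlas_cover : forall x : msort, exists2 c, atlas c & chart_dom c x;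
  atlas_compat : forall c d, atlas c -> atlas d -> smooth_transition c d
}.

Section SmoothFunctions.
Variables (R : realType) (n : nat) (M : manifold R n).

Definition smooth (f : M -> R) :=
  forall c, atlas c -> smooth_on (c @` chart_dom c) (f \o chart_inv c).

Definition smooth_pred : {pred M -> R} := mem [set f | smooth f].

Record smooth_fun := SmoothFun {
  smooth_val :> M -> R;
  smooth_valP : smooth_val \in smooth_pred
}.

HB.instance Definition _ := [isSub for smooth_val].
HB.instance Definition _ := [Choice of smooth_fun by <:].

Lemma smooth_cst (c : R) : cst c \in smooth_pred.
Proof. by rewrite inE => d ad k; exact: (Ck_cst k c (chart_img_open d)). Qed.

Lemma smooth_subring : subring_closed smooth_pred.
Proof.
have smN (f : M -> R) : f \in smooth_pred -> - f \in smooth_pred.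
  rewrite !inE => sf d ad k; have oU := chart_img_open d.
  apply: eq_Ck (Ck_mul oU (Ck_cst k (-1) oU) (sf d ad k)) => // x _ /=.
  by rewrite mulN1r.
split; first exact: smooth_cst.
  move=> f g sf /smN; move: sf; rewrite !inE => sf sg d ad k.
  exact: Ck_add (chart_img_open d) (sf d ad k) (sg d ad k).
move=> f g; rewrite !inE => sf sg d ad k.
exact: Ck_mul (chart_img_open d) (sf d ad k) (sg d ad k).
Qed.

HB.instance Definition _ :=
  GRing.isSubringClosed.Build (M -> R) smooth_pred smooth_subring.
HB.instance Definition _ :=
  GRing.SubChoice_isSubComPzRing.Build (M -> R) smooth_pred smooth_fun
    smooth_subring.

Definition csf (c : R) : smooth_fun := SmoothFun (smooth_cst c).

End SmoothFunctions.

(* A vector field is an R-linear derivation of C^oo(M): its value at [x] is the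
  tangent vector [f |-> X f x], an R-linear point derivation at [x], and
  smoothness of the field is smoothness of [x |-> X f x] for every smooth
  [f]. *)

Section VectorFields.
Variables (R : realType) (n : nat) (M : manifold R n).
Notation C := (smooth_fun M).

Definition derivation (D : C -> C^o) :=
  (forall (c : R) f h, D (csf M c * f + h) = csf M c * D f + D h) /\
  (forall f h, D (f * h) = f * D h + h * D f).

Definition derivation_pred : {pred C -> C^o} := mem [set D | derivation D].

Record vfield := VField {
  vfield_val :> C -> C^o;
  vfield_valP : vfield_val \in derivation_pred
}.

HB.instance Definition _ := [isSub for vfield_val].
HB.instance Definition _ := [Choice of vfield by <:].

Lemma derivation_submod : submod_closed derivation_pred.
Proof.
split.
  by rewrite inE; split=> * /=; rewrite /= !mulr0 addr0.
move=> a D E; rewrite !inE => -[Dl DM] [El EM].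
have ZDE f : (a *: D + E) f = a * D f + E f by [].
by split=> [c f h|f h]; rewrite !ZDE ?Dl ?El ?DM ?EM; ring.
Qed.

HB.instance Definition _ :=
  GRing.SubChoice_isSubLmodule.Build C (C -> C^o) derivation_pred vfield
    derivation_submod.

Lemma vfield_lin (X : vfield) c f h : X (csf M c * f + h) = csf M c * X f + X h.
Proof. by have := vfield_valP X; rewrite inE => -[]. Qed.

Lemma vfieldM (X : vfield) f h : X (f * h) = f * X h + h * X f.
Proof. by have := vfield_valP X; rewrite inE => -[]. Qed.

Lemma vfieldD (X : vfield) f h : X (f + h) = X f + X h.
Proof.
have csf1 : csf M 1 = 1 by apply: val_inj.
by have := vfield_lin X 1 f h; rewrite csf1 !mul1r.
Qed.

Lemma lie_subproof (X Y : vfield) :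
  (fun f => X (Y f) - Y (X f) : C^o) \in derivation_pred.
Proof.
rewrite inE; split=> [c f h|f h]; first by rewrite !vfield_lin; ring.
by rewrite !vfieldM !vfieldD !vfieldM; ring.
Qed.

Definition lie (X Y : vfield) : vfield := VField (lie_subproof X Y).

End VectorFields.

(* A bundle morphism is identified with the C^oo(M)-linear map it induces on
  sections. In particular, a 1-form is a C^oo(M)-linear map from vector fields
  to C^oo(M), and a (1,1)-tensor field is a C^oo(M)-linear endomorphism of the
  module of vector fields. *)

Section Tensors.
Variables (R : realType) (n : nat) (M : manifold R n).
Notation C := (smooth_fun M).
Notation X := (vfield M).

Definition form_pred : {pred X -> C^o} := mem [set a | linear (a : X -> C^o)].

Record one_form := OneForm {
  form_val :> X -> C^o;
  form_valP : form_val \in form_pred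
}.

HB.instance Definition _ := [isSub for form_val].
HB.instance Definition _ := [Choice of one_form by <:].

Lemma form_submod : submod_closed form_pred.
Proof.
split; first by rewrite inE => a u v /=; rewrite scaler0 addr0.
move=> c a b; rewrite !inE => la lb d u v.
have E w : (c *: a + b) w = c * a w + b w by [].
by rewrite !E la lb /GRing.scale /=; ring.
Qed.

HB.instance Definition _ :=
  GRing.SubChoice_isSubLmodule.Build C (X -> C^o) form_pred one_form form_submod.

Lemma form_linear (a : one_form) : linear (a : X -> C^o).
Proof. by have := form_valP a; rewrite inE. Qed.

HB.instance Definition _ (a : one_form) :=
  GRing.isLinear.Build C X C^o *:%R (form_val a) (form_linear a).

(* Positive definiteness is pointwise: the value of [U] at [x] is nonzero when
   [U f x != 0] for some smooth [f]. *)
Record riemannian_metric := RiemannianMetric {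
  rmetric :> X -> X -> C;
  rmetric_linear : forall W, linear (fun U => rmetric U W : C^o);
  rmetric_sym : forall U W, rmetric U W = rmetric W U;
  rmetric_pos : forall (U : X) (x : M),
    (exists f : C, (U f : C) x != 0) -> 0 < rmetric U U x
}.

(* Covariant derivative [nabla U W] of [W] in the direction [U]. *)
Record connection := Connection {
  nabla :> X -> X -> X;
  nabla_linear : forall W, linear (fun U => nabla U W);
  nablaD : forall U W Z, nabla U (W + Z) = nabla U W + nabla U Z;
  nabla_leibniz : forall U (f : C) W,
    nabla U (f *: W) = (U f : C) *: W + f *: nabla U W
}.

Lemma nabla_form_subproof (D : connection) (U : X) (a : one_form) :
  (fun W => U (a W) - a (D U W) : C^o) \in form_pred.
Proof.
rewrite inE => f W Z.
have scE (h k : C) : h *: (k : C^o) = h * k by [].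
by rewrite nablaD nabla_leibniz !linearD !linearZ /= vfieldD vfieldM !scE; ring.
Qed.

Definition nabla_form (D : connection) (U : X) (a : one_form) : one_form :=
  OneForm (nabla_form_subproof D U a).

Definition nabla_end (D : connection) (U : X) (J : {linear X -> X}) (W : X) : X :=
  D U (J W) - J (D U W).

Definition metallic (p q : R) (V : lmodType C) (A : V -> V) :=
  forall s, A (A s) = csf M p *: A s + csf M q *: s.

Definition metallic_riemannian (p q : R) (J : {linear X -> X})
    (g : riemannian_metric) :=
  metallic p q J /\ forall U W, g (J U) W = g U (J W).

Definition nijenhuis (V : zmodType) (br : V -> V -> V) (A : V -> V) (s t : V) :=
  br (A s) (A t) - A (br (A s) t) - A (br s (A t)) + A (A (br s t)).

Definition tensor_integrable (J : {linear X -> X}) :=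
  forall U W, nijenhuis (@lie R n M) J U W = 0.

(* Sections of TM (+) T*M; the pair [(U, a)] stands for U + a. *)
Notation gsection := (X * one_form)%type.

Definition nabla_bracket (D : connection) (s t : gsection) : gsection :=
  (lie s.1 t.1, nabla_form D s.1 t.2 - nabla_form D t.1 s.2).

Definition nabla_integrable (D : connection) (A : {linear gsection -> gsection}) :=
  forall s t, nijenhuis (nabla_bracket D) A s t = 0.

Lemma dual_subproof (J : {linear X -> X}) (a : one_form) :
  (fun W => a (J W)) \in form_pred.
Proof. by rewrite inE => f W Z; rewrite !linearP. Qed.

Definition dual_end (J : {linear X -> X}) (a : one_form) : one_form :=
  OneForm (dual_subproof J a).

Definition Jm (J : {linear X -> X}) (s : gsection) : gsection :=
  (J s.1, dual_end J s.2).

Lemma Jm_linear (J : {linear X -> X}) : linear (Jm J).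
Proof.
move=> f s t; rewrite /Jm /= linearP; congr pair.
by apply: val_inj; apply/funext => W.
Qed.

HB.instance Definition _ (J : {linear X -> X}) :=
  GRing.isLinear.Build C gsection gsection *:%R (Jm J) (Jm_linear J).

Lemma Jm_metallic p q (J : {linear X -> X}) :
  metallic p q J -> metallic p q (Jm J).
Proof.
move=> mJ [U a]; rewrite /Jm /= mJ; congr pair.
by apply: val_inj; apply/funext => W /=; rewrite mJ linearD !linearZ.
Qed.

End Tensors.

(* Main.v *)
Require Import Defs.
From mathcomp Require Import all_boot all_order all_algebra.
From mathcomp Require Import all_classical all_reals all_analysis.
From mathcomp Require Import ring.

(** The vector component of the [nabla]-Nijenhuis tensor of [Jm J] at
    [X + a], [Y + b] is the ordinary Nijenhuis tensor of [J] at [X], [Y]. In its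
    1-form component every derivative of a function cancels, since the dual of
    [J] acts by precomposition: the terms [(J X) (b (J W))] and
    [X (b (J (J W)))] each occur twice, with opposite signs. What is left is
    [b] evaluated at the defect
      [(nabla_{J X} J) W - (nabla_X J) (J W)],
    minus the same expression with the two sections exchanged
    ([nijenhuis_Jm_form]). Hence the vanishing of both components follows from
    the integrability of [J] and the vanishing of the defect. Conversely, the
    sections [X] and [b] alone isolate the value of [b] at the defect, and
    1-forms separate vector fields because the metric dual of a nonzero field
    does not vanish on that field ([form_separates]). *)

Import Order.TTheory GRing.Theory Num.Theory.
Local Open Scope ring_scope.

Section GeneralizedNijenhuis.
Context {R : realType} {n : nat} {M : manifold R n}.
Implicit Types (J : {linear vfield M -> vfield M}) (D : connection M)
  (X Y V W : vfield M) (a b : one_form M) (s t : vfield M * one_form M).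

Lemma vfield_eq0 V : (forall f x, (V f : smooth_fun M) x = 0) -> V = 0.
Proof.
move=> V0; apply: val_inj; apply/funext => f.
by apply: val_inj; apply/funext => x; exact: V0.
Qed.

Section MetricDual.
Variable g : riemannian_metric M.

Lemma metric_dual_subproof V :
  (fun W => g W V : (smooth_fun M)^o) \in form_pred (M := M).
Proof. by rewrite inE; exact: rmetric_linear. Qed.

Definition metric_dual V : one_form M := OneForm (metric_dual_subproof V).

(** Positivity of the metric replaces an extension of covectors by bump
    functions: the metric dual of [V] takes at [V] the value [g V V], which is
    positive wherever [V] is nonzero. *)
Lemma form_separates V : (forall b, b V = 0) -> V = 0.
Proof.
move=> V0; apply: vfield_eq0 => f x; apply/eqP/negPn/negP => Vfx.
have : 0 < g V V x by apply: rmetric_pos; exists f.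
have /= -> := V0 (metric_dual V).
by rewrite /= ltxx.
Qed.

End MetricDual.

Definition parallel_defect D J X W : vfield M :=
  nabla_end D (J X) J W - nabla_end D X J (J W).

Lemma nijenhuis_Jm_vfield D J s t :
  (nijenhuis (nabla_bracket D) (Jm J) s t).1
  = nijenhuis (@lie R n M) J s.1 t.1.
Proof. by []. Qed.

(** The key computation: a first-order expression in [s] and [t] turns out to
    be algebraic, so that 1-forms can be tested pointwise on the defect. *)
Lemma nijenhuis_Jm_form D J s t W :
  (nijenhuis (nabla_bracket D) (Jm J) s t).2 W
  = t.2 (parallel_defect D J s.1 W) - s.2 (parallel_defect D J t.1 W).
Proof.
rewrite /nijenhuis /parallel_defect /nabla_end /= !fctE !linearB /=.
ring.
Qed.

(** Testing on a vector field paired with a 1-form shows that every 1-form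
    vanishes on the defect, so the defect vanishes as soon as 1-forms separate
    vector fields. *)
Lemma nabla_integrable_JmP D J :
  (forall V, (forall b, b V = 0) -> V = 0) ->
  nabla_integrable D (Jm J) <->
  tensor_integrable J /\ (forall X W, parallel_defect D J X W = 0).
Proof.
move=> sep; split=> [NJm | [NJ defect0] s t].
  split=> [X Y | X W].
    by have /(congr1 fst) := NJm (X, 0) (Y, 0); rewrite nijenhuis_Jm_vfield.
  apply: sep => b.
  have /(congr1 (fun s : vfield M * one_form M => s.2 W)) := NJm (X, 0) (0, b).
  by rewrite nijenhuis_Jm_form => bdefect0; rewrite -[LHS]subr0; exact: bdefect0.
apply: injective_projections; first by rewrite nijenhuis_Jm_vfield NJ.
apply: val_inj; apply/funext => W.
by rewrite [LHS]nijenhuis_Jm_form !defect0 !linear0 addr0.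
Qed.

End GeneralizedNijenhuis.

Theorem proposition2p4 (R : realType) (n : nat) (M : manifold R n) (p q : R)
    (J : {linear vfield M -> vfield M}) (g : riemannian_metric M)
    (nabla : connection M) :
  metallic_riemannian p q J g ->
  nabla_integrable nabla (Jm J) <->
  tensor_integrable J /\
  (forall X : vfield M, nabla_end nabla (J X) J = nabla_end nabla X J \o J).
Proof.
move=> _; rewrite (nabla_integrable_JmP _ _ (form_separates g)).
split=> -[NJ defect0]; split=> //.
  by move=> X; apply/funext => W; apply/eqP; rewrite -subr_eq0; apply/eqP/defect0.
by move=> X W; rewrite /parallel_defect defect0 subrr.
Qed.
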